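(* Let $m=(m_0,m_1,m_2)\in\mathbb{R}^3$ with $m_0,m_1,m_2$ all nonzero and $m_2\neq\pm1$. Put $q=m_0^2(m_2-1)^2+(m_2+1)^2$ and $r=\frac{(m_0^2+1)(1-m_2^2)}{q}$. Let $p^0=(0,0,0)$, $p^1=(1,0,0)$, $p^2=(1+x_1,x_2,x_3)$, $p^3=(y_1,y_2,0)$ with $$x_1=\frac{r(m_1^2-1)}{m_1^2+1},\quad x_2=\frac{2rm_1(m_0^2-1)}{(m_0^2+1)(m_1^2+1)},\quad x_3=\frac{4rm_0m_1}{(m_0^2+1)(m_1^2+1)},$$ $$y_1=\frac{r(m_1^2-m_2^2)}{m_1^2+m_2^2},\quad y_2=\frac{2rm_1m_2}{m_1^2+m_2^2},$$ and let $\chi^0=(0,0,1)$, $\chi^1=\frac{1}{m_0^2+1}\,(0,\,-2m_0,\,m_0^2-1)$, $$\chi^2=\frac{1}{(m_0^2+1)(m_1^2+1)q}\begin{pmatrix}4m_0m_1(1-m_2^2)(m_0^2+1)\\ 4m_0\big((1-m_0^2)(m_1^2+m_2^2)+m_2(m_0^2+1)(m_1^2+1)\big)\\ (m_2-1)^2(m_1^2+1)m_0^4+2\big((m_2^2-3)m_1^2-3m_2^2+1\big)m_0^2+(m_2+1)^2(m_1^2+1)\end{pmatrix},$$ $$\chi^3=\frac{1}{(m_1^2+m_2^2)q}\begin{pmatrix}4m_0m_1m_2(1-m_2^2)\\ 2m_0(m_2^2-m_1^2)(1-m_2^2)\\ (m_0m_2-m_0+m_2+1)(m_0m_2-m_0-m_2-1)(m_1^2+m_2^2)\end{pmatrix}.$$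 Then all of Bennett's conditions are satisfied: with $v^\ell=p^{\ell+1}-p^\ell$ and $\varphi_\ell$ the angle between $\chi^\ell$ and $\chi^{\ell+1}$, 1. $|v^0|=|v^2|$ and $|v^1|=|v^3|$; 2. $\varphi_0=\varphi_2$ and $\varphi_1=\varphi_3$; 3. $|v^0|\sin(\varphi_1)=|v^1|\sin(\varphi_0)$.
   Context: Indices are cyclic modulo 4: $p^4=p^0$ and $\chi^4=\chi^0$. Angles between vectors are taken in $[0,\pi]$. (Here $p^\ell$ are the joint locations and $\chi^\ell$ the rotation axes of a closed chain of four rigid bodies connected by four revolute joints.) *)

(* Defs.v *)
From mathcomp Require Import all_boot all_order all_algebra.
From mathcomp Require Import reals trigo.

Set Implicit Arguments.
Unset Strict Implicit.
Unset Printing Implicit Defensive.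

Import Order.TTheory GRing.Theory Num.Theory.
Local Open Scope ring_scope.

Section Euclidean.
Variable R : realType.
Implicit Types u v : 'rV[R]_3.

Definition vec3 (a b c : R) : 'rV[R]_3 := \row_(j < 3) [:: a; b; c]`_j.

Definition dotv u v : R := (u *m v^T) 0 0.

(* The library norm on matrices is the sup norm, hence this definition. *)
Definition enorm u : R := Num.sqrt (dotv u u).

(* For nonzero u and v this is the unoriented angle in [0, pi]; it is
   meaningless if u or v is zero. *)
Definition angle u v : R := acos (dotv u v / (enorm u * enorm v)).

End Euclidean.

(* Joints and axes are indexed by 'Z_4, so that l + 1 is cyclic modulo 4. *)
Section Bennett.
Variable R : realType.
Implicit Types p chi : 'Z_4 -> 'rV[R]_3.

Definition link p (l : 'Z_4) : 'rV[R]_3 := p (l + 1) - p l.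

Definition twist chi (l : 'Z_4) : R := angle (chi l) (chi (l + 1)).

Definition bennett_conditions p chi : Prop :=
  [/\ enorm (link p 0) = enorm (link p 2) /\
      enorm (link p 1) = enorm (link p 3),
      twist chi 0 = twist chi 2 /\ twist chi 1 = twist chi 3
    & enorm (link p 0) * sin (twist chi 1) =
      enorm (link p 1) * sin (twist chi 0)].

End Bennett.

Section Parametrization.
Variables (R : realType) (m0 m1 m2 : R).

Definition par_q : R := m0 ^+ 2 * (m2 - 1) ^+ 2 + (m2 + 1) ^+ 2.

Definition par_r : R := (m0 ^+ 2 + 1) * (1 - m2 ^+ 2) / par_q.

Definition par_x1 : R := par_r * (m1 ^+ 2 - 1) / (m1 ^+ 2 + 1).

Definition par_x2 : R :=
  2 * par_r * m1 * (m0 ^+ 2 - 1) / ((m0 ^+ 2 + 1) * (m1 ^+ 2 + 1)).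

Definition par_x3 : R :=
  4 * par_r * m0 * m1 / ((m0 ^+ 2 + 1) * (m1 ^+ 2 + 1)).

Definition par_y1 : R :=
  par_r * (m1 ^+ 2 - m2 ^+ 2) / (m1 ^+ 2 + m2 ^+ 2).

Definition par_y2 : R := 2 * par_r * m1 * m2 / (m1 ^+ 2 + m2 ^+ 2).

Definition joint (l : 'Z_4) : 'rV[R]_3 :=
  [:: vec3 0 0 0;
      vec3 1 0 0;
      vec3 (1 + par_x1) par_x2 par_x3;
      vec3 par_y1 par_y2 0]`_l.

Definition axis1 : 'rV[R]_3 :=
  (m0 ^+ 2 + 1)^-1 *: vec3 0 (- (2 * m0)) (m0 ^+ 2 - 1).

Definition axis2 : 'rV[R]_3 :=
  ((m0 ^+ 2 + 1) * (m1 ^+ 2 + 1) * par_q)^-1 *: vec3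
    (4 * m0 * m1 * (1 - m2 ^+ 2) * (m0 ^+ 2 + 1))
    (4 * m0 * ((1 - m0 ^+ 2) * (m1 ^+ 2 + m2 ^+ 2)
               + m2 * (m0 ^+ 2 + 1) * (m1 ^+ 2 + 1)))
    ((m2 - 1) ^+ 2 * (m1 ^+ 2 + 1) * m0 ^+ 4
     + 2 * ((m2 ^+ 2 - 3) * m1 ^+ 2 - 3 * m2 ^+ 2 + 1) * m0 ^+ 2
     + (m2 + 1) ^+ 2 * (m1 ^+ 2 + 1)).

Definition axis3 : 'rV[R]_3 :=
  ((m1 ^+ 2 + m2 ^+ 2) * par_q)^-1 *: vec3
    (4 * m0 * m1 * m2 * (1 - m2 ^+ 2))
    (2 * m0 * (m2 ^+ 2 - m1 ^+ 2) * (1 - m2 ^+ 2))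
    ((m0 * m2 - m0 + m2 + 1) * (m0 * m2 - m0 - m2 - 1)
     * (m1 ^+ 2 + m2 ^+ 2)).

Definition axis (l : 'Z_4) : 'rV[R]_3 :=
  [:: vec3 0 0 1; axis1; axis2; axis3]`_l.

End Parametrization.

(* Main.v *)
(* All four axes are unit vectors, so the twist angles are the arccosines of
   the dot products of consecutive axes; these are c0 = (m0^2-1)/(m0^2+1) for
   l = 0, 2 and a rational function c1 for l = 1, 3.  The links have squared
   length 1 and r^2 alternately.  With s0 = 2 m0/(m0^2+1) the identities
   c0^2 + s0^2 = 1 and c1^2 + (r s0)^2 = 1 give sin phi_0 = |s0| and
   sin phi_1 = |r s0|, which is the last condition. *)
Require Import Defs.
From mathcomp Require Import all_boot all_order all_algebra.
From mathcomp Require Import reals trigo.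
From mathcomp Require Import ring.

Import Order.TTheory GRing.Theory Num.Theory.
Local Open Scope ring_scope.

Section Vec3.
Variable R : realType.
Implicit Types (a b c d : R) (u v : 'rV[R]_3).

Lemma dotv_vec3 a b c a' b' c' :
  dotv (vec3 a b c) (vec3 a' b' c') = a * a' + b * b' + c * c'.
Proof.
by rewrite /dotv mxE !big_ord_recr big_ord0 /= add0r !mxE /=.
Qed.

Lemma scale_vec3 d a b c : d *: vec3 a b c = vec3 (d * a) (d * b) (d * c).
Proof. by apply/rowP; case=> [[|[|[|//]]] ?]; rewrite !mxE. Qed.

Lemma sub_vec3 a b c a' b' c' :
  vec3 a b c - vec3 a' b' c' = vec3 (a - a') (b - b') (c - c').
Proof. by apply/rowP; case=> [[|[|[|//]]] ?]; rewrite !mxE. Qed.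

Lemma angle_unit u v : dotv u u = 1 -> dotv v v = 1 ->
  angle u v = acos (dotv u v).
Proof. by move=> uu vv; rewrite /angle /enorm uu vv sqrtr1 mulr1 divr1. Qed.

End Vec3.

Section BennettParametrization.
Variables (R : realType) (m0 m1 m2 : R).
Hypotheses (m0_neq0 : m0 != 0) (m1_neq0 : m1 != 0).

Let p := joint m0 m1 m2.
Let chi := axis m0 m1 m2.

Lemma sqr_add_sqr_neq0 (a b : R) : a != 0 -> a ^+ 2 + b ^+ 2 != 0.
Proof. by move=> a0; rewrite paddr_eq0 ?sqr_ge0// sqrf_eq0 (negPf a0). Qed.

Lemma sqr_add1_neq0 (a : R) : a ^+ 2 + 1 != 0.
Proof. by rewrite gt_eqF// ltr_wpDl ?sqr_ge0. Qed.

(** Since [m0] is nonzero, the two squares could vanish together only if [m2] were both 1 and -1. *)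
Lemma par_q_neq0 : par_q m0 m2 != 0.
Proof.
rewrite /par_q; have [->|m2_neq1] := eqVneq m2 1.
  by rewrite subrr expr0n mulr0 add0r sqrf_eq0 gt_eqF// addr_gt0.
by rewrite -exprMn sqr_add_sqr_neq0// mulf_neq0// subr_eq0.
Qed.

Let A0 := sqr_add1_neq0 m0.
Let B0 := sqr_add1_neq0 m1.
Let C0 : m1 ^+ 2 + m2 ^+ 2 != 0 := sqr_add_sqr_neq0 m1 m2 m1_neq0.
(** [field] merges the product of two squares into one square in its side conditions; this form
    matches them. *)
Let Q0 : (m0 * (m2 - 1)) ^+ 2 + (m2 + 1) ^+ 2 != 0.
Proof. by rewrite exprMn; exact: par_q_neq0. Qed.

Ltac field_par :=
  rewrite /par_x1 /par_x2 /par_x3 /par_y1 /par_y2 /par_r /par_q;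
  field; rewrite ?A0 ?B0 ?C0 ?Q0.

Lemma dotv_link0 : dotv (link p 0) (link p 0) = 1.
Proof. by rewrite /link /p /joint /= sub_vec3 dotv_vec3; ring. Qed.

Lemma dotv_link1 : dotv (link p 1) (link p 1) = par_r m0 m2 ^+ 2.
Proof. by rewrite /link /p /joint /= sub_vec3 dotv_vec3; field_par. Qed.

Lemma dotv_link2 : dotv (link p 2) (link p 2) = 1.
Proof. by rewrite /link /p /joint /= sub_vec3 dotv_vec3; field_par. Qed.

Lemma dotv_link3 : dotv (link p 3) (link p 3) = par_r m0 m2 ^+ 2.
Proof. by rewrite /link /p /joint /= sub_vec3 dotv_vec3; field_par. Qed.

Ltac axis_par :=
  rewrite /chi /axis /axis1 /axis2 /axis3 /= ?scale_vec3 dotv_vec3; field_par.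

Lemma dotv_axis00 : dotv (chi 0) (chi 0) = 1.
Proof. by rewrite /chi /axis /= dotv_vec3; ring. Qed.

Lemma dotv_axis11 : dotv (chi 1) (chi 1) = 1.
Proof. by axis_par. Qed.

Lemma dotv_axis22 : dotv (chi 2) (chi 2) = 1.
Proof. by axis_par. Qed.

Lemma dotv_axis33 : dotv (chi 3) (chi 3) = 1.
Proof. by axis_par. Qed.

Let c0 := (m0 ^+ 2 - 1) / (m0 ^+ 2 + 1).
Let c1 := (m0 ^+ 2 * (m2 - 1) ^+ 2 - (m2 + 1) ^+ 2) / par_q m0 m2.

Lemma dotv_axis01 : dotv (chi 0) (chi 1) = c0.
Proof. by rewrite /c0; axis_par. Qed.

Lemma dotv_axis12 : dotv (chi 1) (chi 2) = c1.
Proof. by rewrite /c1; axis_par. Qed.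

Lemma dotv_axis23 : dotv (chi 2) (chi 3) = c0.
Proof. by rewrite /c0; axis_par. Qed.

Lemma dotv_axis30 : dotv (chi 3) (chi 0) = c1.
Proof. by rewrite /c1; axis_par. Qed.


Lemma twist0 : twist chi 0 = acos c0.
Proof.
by rewrite /twist angle_unit ?dotv_axis00 ?dotv_axis11 ?dotv_axis01.
Qed.

Lemma twist1 : twist chi 1 = acos c1.
Proof.
by rewrite /twist angle_unit ?dotv_axis11 ?dotv_axis22 ?dotv_axis12.
Qed.

Lemma twist2 : twist chi 2 = acos c0.
Proof.
by rewrite /twist angle_unit ?dotv_axis22 ?dotv_axis33 ?dotv_axis23.
Qed.

Lemma twist3 : twist chi 3 = acos c1.
Proof.
have -> : twist chi 3 = angle (chi 3) (chi 0).
  (* The index wraps around: [3 + 1] and [0] in 'Z_4 have the same underlying natural number. *)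
  by rewrite /twist; congr (angle _ (chi _)); apply/val_inj.
by rewrite angle_unit ?dotv_axis33 ?dotv_axis00 ?dotv_axis30.
Qed.

(** Sine is nonnegative on [0, pi], the range of [acos], so the square root of 1 - c^2 = s^2 is
    taken, whatever the sign of s. *)
Lemma sin_acos_norm (c s : R) : c ^+ 2 + s ^+ 2 = 1 ->
  sin (acos c) = `|s|.
Proof.
move=> cs; have /andP[c_geN1 c_le1] : -1 <= c <= 1.
  (* The bound is squared and becomes c^2 <= c^2 + s^2. *)
  rewrite -ler_norml -(@expr_le1 _ 2)// real_normK ?num_real// -cs.
  by rewrite lerDl sqr_ge0.
by rewrite sin_acos ?c_geN1// -cs addrAC subrr add0r sqrtr_sqr.
Qed.

Lemma sin_twist0 : sin (twist chi 0) = `|2 * m0 / (m0 ^+ 2 + 1)|.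
Proof. by rewrite twist0; apply: sin_acos_norm; rewrite /c0; field_par. Qed.

(** With a = m0 (m2 - 1) and b = m2 + 1, [c1] is (a^2 - b^2)/(a^2 + b^2) and the expression inside
    the absolute value is -2ab/(a^2 + b^2): the half-angle form of a cosine and, up to sign, its
    sine. *)
Lemma sin_twist1 :
  sin (twist chi 1) = `|par_r m0 m2 * (2 * m0 / (m0 ^+ 2 + 1))|.
Proof. by rewrite twist1; apply: sin_acos_norm; rewrite /c1; field_par. Qed.

End BennettParametrization.

Theorem theorem5p1 (R : realType) (m0 m1 m2 : R)
    (m0_neq0 : m0 != 0) (m1_neq0 : m1 != 0) (m2_neq0 : m2 != 0)
    (m2_neq1 : m2 != 1) (m2_neqN1 : m2 != -1) :
  bennett_conditions (joint m0 m1 m2) (axis m0 m1 m2).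
Proof.
split.
- by rewrite /enorm dotv_link0 dotv_link1 ?dotv_link2 ?dotv_link3.
- by rewrite twist0 ?twist1 ?twist2 ?twist3.
- rewrite sin_twist1// sin_twist0// /enorm dotv_link0 dotv_link1//.
  (* [par_r] is negative when |m2| > 1, so the length of link 1 is its absolute value, which factors
     out of the sine of twist 1. *)
  by rewrite sqrtr1 mul1r sqrtr_sqr normrM.
Qed.
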